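(* Let $\rho\in(0,1)$. There exists a constant $C_\rho>0$ depending only on $\rho$ with the following property. Let $(X_i)_{i\in\mathbb{N}}$ be a sequence of free identically distributed bounded self-adjoint random variables with distribution $\mu$ for some probability measure $\mu$ on $\mathbb{R}$. Assume that $\mu$ has mean zero, unit variance, and compact support in $[-L,L]$ for some $L>0$. For $\theta\in\mathbb{S}^{n-1}$ denote by $\mu_\theta$ the distribution of $S_\theta=\theta_1X_1+\dots+\theta_nX_n$. Then there exist $n_{\rho,\mu}\in\mathbb{N}$ and, for each $n$, a measurable set $\mathcal{F}=\mathcal{F}_n\subset\mathbb{S}^{n-1}$ with $\sigma_{n-1}(\mathcal{F})\ge1-\rho$ such that for all $n\ge n_{\rho,\mu}$ and all $\theta\in\mathcal{F}$ we have $$\operatorname{supp}\mu_\theta\subset\left(-2-\frac{C_\rho(768L^4+6|m_3(\mu)|)}{n},\;2+\frac{C_\rho(768L^4+6|m_3(\mu)|)}{n}\right),$$ where $m_3(\mu)$ denotes the third moment of $\mu$.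
   Context: $\mathbb{S}^{n-1}$ is the unit sphere of $\mathbb{R}^n$ and $\sigma_{n-1}$ is the uniform probability measure on it. The $X_i$ are bounded self-adjoint random variables in a tracial noncommutative probability space, free in Voiculescu's sense. The distribution of $S_\theta$ is the free additive convolution $\mu_\theta=\mu_1\boxplus\dots\boxplus\mu_n$, where $\mu_i=D_{\theta_i}\mu$ is the push-forward of $\mu$ under $x\mapsto\theta_i x$. Analytically, with $G_\nu(z)=\int\frac{1}{z-t}\nu(dt)$ and $F_\nu=1/G_\nu$ on the upper half-plane $\mathbb{C}^+$, the measure $\nu=\nu_1\boxplus\dots\boxplus\nu_n$ is the probability measure with $F_\nu(z)=F_{\nu_1}(Z_1(z))$, where $Z_1,\dots,Z_n:\mathbb{C}^+\to\mathbb{C}^+$ are the unique holomorphic functions with $Z_1(z)+\dots+Z_n(z)-z=(n-1)F_{\nu_1}(Z_1(z))$ and $F_{\nu_1}(Z_1(z))=\dots=F_{\nu_n}(Z_n(z))$ for all $z\in\mathbb{C}^+$. *)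

(* Defs.v *)
From HB Require Import structures.
From mathcomp Require Import all_boot all_order all_algebra.
From mathcomp Require Import all_classical all_reals all_analysis.
From mathcomp.real_closed Require Export complex.

Set Implicit Arguments.
Unset Strict Implicit.
Unset Printing Implicit Defensive.

Import Order.TTheory GRing.Theory Num.Theory.
Import numFieldNormedType.Exports.

Local Open Scope classical_set_scope.
Local Open Scope ring_scope.
Local Open Scope complex_scope.

Definition supp (R : realType) (mu : probability (measurableTypeR R) R) :
    set R :=
  [set x | forall U : set R, open U -> U x -> (0 < mu U)%E].

(* [\int[mu]_t _] is [Rintegral]; it is only used for compactly supported [mu],
   for which every power is integrable. *)
Definition moment (R : realType) (mu : probability (measurableTypeR R) R)
    (k : nat) : R :=
  \int[mu]_t (t ^+ k).

Definition sphere (R : realType) (n : nat) : set 'rV[R]_n :=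
  [set v | \sum_(i < n) v ord0 i ^+ 2 = 1].

(* R^n with its Borel sigma-algebra. *)
Definition borel_rV (R : realType) (n : nat) :=
  g_sigma_algebraType (@open 'rV[R]_n).

(* The uniform probability measure on the sphere is the unique Borel probability
   measure carried by the sphere and invariant under the orthogonal group; it
   exists exactly for n > 0. *)
Definition uniform_on_sphere (R : realType) (n : nat)
    (sigma : probability (borel_rV R n) R) : Prop :=
  sigma (@sphere R n) = 1%E /\
  forall (U : 'M[R]_n) (B : set (borel_rV R n)),
    U *m U^T = 1%:M -> measurable B ->
    sigma [set v : 'rV[R]_n | B (v *m U)] = sigma B.

(* A unital complex *-algebra with a tracial state. No topology is required:
   C*- and W*-probability spaces with a tracial state are instances. *)
Record tracialNCPSpace (R : realType) := TracialNCPSpace {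
  ncps_alg :> algType R[i];
  star : ncps_alg -> ncps_alg;
  state : {scalar ncps_alg};
  starK : involutive star;
  starD : {morph star : x y / x + y};
  starM : forall x y, star (x * y) = star y * star x;
  starZ : forall (c : R[i]) x, star (c *: x) = c^* *: star x;
  state1 : state 1 = 1;
  state_ge0 : forall x, 0 <= state (star x * x);
  state_tracial : forall x y, state (x * y) = state (y * x)
}.

Arguments state {R _}.

Definition selfadjoint (R : realType) (A : tracialNCPSpace R) (x : A) : Prop :=
  star x = x.

(* Left multiplication by [x] is bounded for the seminorm
   [a |-> state (star a * a) ^ (1/2)], i.e. [x] acts as a bounded operator on the
   GNS space. In a C*-probability space this holds for all [x]. *)
Definition bounded_rv (R : realType) (A : tracialNCPSpace R) (x : A) : Prop :=
  exists K : R, forall a : A,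
    state (star (x * a) * (x * a)) <= K%:C * state (star a * a).

(* The distribution of a bounded self-adjoint variable is the compactly supported
   probability measure with the same moments; it is unique. *)
Definition has_distribution (R : realType) (A : tracialNCPSpace R) (x : A)
    (mu : probability (measurableTypeR R) R) : Prop :=
  (exists M : R, supp mu `<=` `[- M, M]) /\
  forall k : nat, state (x ^+ k) = (moment mu k)%:C.

(* Alternating products of centred elements p_1(X_{i_1}) ... p_m(X_{i_m}),
   m >= 1, i_1 != i_2 != ... != i_m, are centred; a letter (i, p) of the word [w]
   encodes p(X_i), and [\prod] over a sequence preserves the order. *)
Definition free_family (R : realType) (A : tracialNCPSpace R) (X : nat -> A) :
    Prop :=
  forall w : seq (nat * {poly R[i]}),
    w != [::] ->
    sorted (fun a b => a.1 != b.1) w ->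
    {in w, forall a, state (horner_alg (X a.1) a.2) = 0} ->
    state (\prod_(a <- w) horner_alg (X a.1) a.2) = 0.

Definition weighted_sum (R : realType) (A : tracialNCPSpace R) (X : nat -> A)
    (n : nat) (theta : 'rV[R]_n) : A :=
  \sum_(i < n) (theta ord0 i)%:C *: X i.

(* Main.v *)
Require Import Defs.
From HB Require Import structures.
From mathcomp Require Import all_boot all_order all_algebra.
From mathcomp Require Import all_classical all_reals all_analysis.
From mathcomp Require Import measurable_realfun.
From mathcomp Require Import ring lra.

(** The support of a compactly supported law lies in [[- x, x]] as soon as its
    [r]-th moment is at most [x ^+ r] in absolute value for all [r], so it is
    enough to bound the moments of [S = weighted_sum X theta] by powers of a
    number [x] slightly larger than 2.

    Let [P_q] be the monic polynomials with [P_0 = 1] and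
    [X P_q = P_(q+1) + sum_(j <= q) k_j P_(q-j)], where the [k_j] are chosen so
    that [P_(q+1)] has mean zero under [mu].  The generating function of the
    [P_q] is [1 / (u(z) - z X)] with [u(z) = 1 + sum_j k_j z^(j+1)] and has mean
    1, which identifies [k_j] with the free cumulant of order [j+1]; in
    particular [k_0 = 0], [k_1 = 1] and [k_2] is the third moment.  Let [T_p] be
    the sum, over all alternating words [(i_1, q_1) ... (i_m, q_m)] with
    [q_1 + ... + q_m = p] and all [q_l > 0], of the products of the elements
    [theta_(i_l)^(q_l) P_(q_l)(X_(i_l))].  Then
    [S T_p = T_(p+1) + sum_(j <= p) K_j T_(p-j)] where
    [K_j = k_j * sum_i theta_i^(j+1)] (lemma
    [free_sum_orthogonal_sequence]); this is the additivity of free cumulants.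
    Freeness gives [state T_p = 0] for [p > 0].  Hence [S] acts on the [T_p] as
    Voiculescu's canonical operator, and an induction on [r] bounds
    [state (S^r T_p)] by [x^r] with [x = 1 + sum_j |K_j|]
    ([orthogonal_sequence_moment_bound]).  The point of the argument is that
    the edge 2 already appears at this crude level, since [K_0 = 0] and
    [K_1 = 1] give [1 + |K_0| + |K_1| = 2]: taking absolute values is harmful
    only for the [K_j] with [j >= 2], and these are small.  Indeed
    [|k_j| <= (6 L)^(j+1)] ([cumulant_bound]), so [x - 2] is at most
    [|m_3| |sum_i theta_i^3| + 2 (6 L)^4 sum_i theta_i^4] once all
    [12 L |theta_i|] are at most 1.

    It remains to see that [sum_i theta_i^4] and [sum_i theta_i^3] are of order
    [1/n] outside a set of measure [rho].  Invariance of the uniform measure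
    under reflections in coordinate planes gives linear relations between
    moments of the coordinates, from which
    [E (sum_i theta_i^4) = 3 / (n + 2)] and
    [E ((sum_i theta_i^3)^2) = 15 / ((n + 2) (n + 4))]; Markov's inequality
    concludes ([size_markov]). *)

Import Order.TTheory GRing.Theory Num.Theory.
Import numFieldNormedType.Exports.

Local Open Scope classical_set_scope.
Local Open Scope ring_scope.

Set Implicit Arguments.
Unset Strict Implicit.

(** * Sums of free variables and their cumulants *)

Lemma course_of_values (B : Type) (d : B) (G : nat -> (nat -> B) -> B) :
    (forall m f g, (forall j, (j < m)%N -> f j = g j) -> G m f = G m g) ->
  exists f : nat -> B, forall m, f m = G m f.
Proof.
move=> Gloc; pose h := fix h s := if s is s'.+1 then fun m => G m (h s')
                                  else fun=> d.
have hE s t m : (m < s)%N -> (m < t)%N -> h s m = h t m.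
  elim: s t m => [|s IH] [|t] m //=; rewrite !ltnS => ms mt.
  by apply: Gloc => j jm; apply: IH; apply: leq_trans jm _.
exists (fun m => h m.+1 m) => m /=; apply: Gloc => j jm.
exact: (hE m j.+1 j).
Qed.

Lemma sum_triangle (V : nmodType) (F : nat -> nat -> V) m :
  \sum_(q < m.+1) \sum_(j < q.+1) F q j =
  \sum_(j < m.+1) \sum_(q < (m - j).+1) F (q + j)%N j.
Proof.
elim: m => [|m IH]; first by rewrite !big_ord1.
rewrite big_ord_recr/= IH [RHS]big_ord_recr/= subnn big_ord1 add0n.
rewrite [X in _ + X]big_ord_recr/= addrA; congr (_ + _).
rewrite -big_split/=; apply: eq_bigr => j _.
have jm : (j <= m)%N by rewrite -ltnS.
by rewrite subSn// [RHS]big_ord_recr/= addSn subnK.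
Qed.

(** Additivity of free cumulants, at the level of vectors.  With
    [P i 0 = 1] and [P i q.+1] thought of as centred elements of the [i]-th free
    algebra, [T p] is the sum of [P i_1 q_1 * ... * P i_m q_m] over alternating
    words of total degree [p].  Splitting off a first letter gives
    [T p = sum_(q <= p) P i q * W i (p - q)], where [W i] collects the words
    that do not start with [i]; so [y i] acts on the first factor only, and the
    terms of degree [p + 1] starting with [i] add up over [i] to [T p.+1]. *)
Lemma free_sum_orthogonal_sequence (K : comNzRingType) (A : algType K)
    (phi : {scalar A}) (n : nat) (y : 'I_n -> A) (P : 'I_n -> nat -> A)
    (k : 'I_n -> nat -> K) :
    (forall i, P i 0%N = 1) ->
    (forall i q, y i * P i q =
       P i q.+1 + \sum_(j < q.+1) k i j *: P i (q - j)%N) ->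
    (forall w : seq ('I_n * nat), w != [::] ->
       sorted (fun a b => a.1 != b.1) w ->
       phi (\prod_(a <- w) P a.1 a.2.+1) = 0) ->
  exists T : nat -> A,
    [/\ T 0%N = 1, forall p, phi (T p.+1) = 0 &
        forall p, (\sum_i y i) * T p =
          T p.+1 + \sum_(j < p.+1) (\sum_i k i j) *: T (p - j)%N].
Proof.
move=> P0 yP free.
(* [f p i] stands for the sum of the words of degree [p] with first colour [i]. *)
pose W (f : nat -> 'I_n -> A) (i : 'I_n) (p : nat) : A :=
  (p == 0%N)%:R + \sum_(l | l != i) f p l.
have [|t tE] := @course_of_values ('I_n -> A) (fun=> 0)
  (fun p f i => \sum_(q < p) P i q.+1 * W f i (p - q.+1)%N).
  move=> p f g fg; apply/funext => i; apply: eq_bigr => q _.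
  congr (_ * (_ + _)).
  by apply: eq_bigr => l _; rewrite fg// ltn_subrL /= (leq_trans _ (ltn_ord q)).
pose T p : A := (p == 0%N)%:R + \sum_i t p i.
have t0 i : t 0%N i = 0 by rewrite tE big_ord0.
have TW p i : T p = t p i + W t i p.
  by rewrite /T /W (bigD1 i)//= addrCA.
have Tconv p i : T p = \sum_(q < p.+1) P i q * W t i (p - q)%N.
  by rewrite (TW p i) tE big_ord_recl P0 mul1r subn0 addrC.
exists T; split.
- by rewrite /T eqxx big1 ?addr0.
(* The induction puts the letters of [t p i] one by one to the right of an
   arbitrary alternating word [v]; the degree 0 only marks the next colour. *)
- have main p (v : seq ('I_n * nat)) (i : 'I_n) :
      sorted (fun a b => a.1 != b.1) (rcons v (i, 0%N)) ->
      phi (\prod_(a <- v) P a.1 a.2.+1 * t p i) = 0.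
    elim/ltn_ind: p v i => p IH v i vi; rewrite tE mulr_sumr linear_sum/=.
    rewrite big1// => q _; rewrite mulrA /W mulrDr linearD/=.
    have -> : \prod_(a <- v) P a.1 a.2.+1 * P i q.+1 =
              \prod_(a <- rcons v (i, q : nat)) P a.1 a.2.+1.
      by rewrite -cats1 big_cat big_seq1.
    have vq : sorted (fun a b => a.1 != b.1) (rcons v (i, q : nat)).
      move: vi; case: v => //= b v; rewrite !rcons_path.
      by move=> /andP[-> /=].
    have -> : phi (\prod_(a <- rcons v (i, q : nat)) P a.1 a.2.+1 *
                (p - q.+1 == 0)%N%:R) = 0.
      case: eqP => _; last by rewrite mulr0 linear0.
      rewrite mulr1; apply: free => //; by case: (v).
    rewrite add0r mulr_sumr linear_sum/= big1// => l li; apply: IH.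
      by rewrite ltn_subrL /= (leq_trans _ (ltn_ord q)).
    move: vq; case: (v) => [_ |b u]; first by rewrite /= eq_sym li.
    rewrite /= !rcons_path => /andP[-> ->] /=.
    by rewrite last_rcons /= eq_sym li.
  move=> p; rewrite /T add0r linear_sum/= big1// => i _.
  by have := @main p.+1 [::] i isT; rewrite big_nil mul1r.
- move=> p.
  have yT i : y i * T p = t p.+1 i + \sum_(j < p.+1) k i j *: T (p - j)%N.
    rewrite (Tconv p i) mulr_sumr tE.
    under eq_bigr do rewrite mulrA yP mulrDl.
    rewrite big_split/=; congr (_ + _).
    under eq_bigr do rewrite mulr_suml.
    rewrite (sum_triangle
      (fun q j => k i j *: P i (q - j)%N * W t i (p - q)%N)).
    apply: eq_bigr => j _; rewrite (Tconv (p - j)%N i) scaler_sumr.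
    by apply: eq_bigr => q _; rewrite addnK addnC subnDA scalerAl.
  rewrite mulr_suml; under eq_bigr do rewrite yT.
  rewrite big_split/= [T p.+1]add0r; congr (_ + _).
  by rewrite exchange_big/=; apply: eq_bigr => j _; rewrite scaler_suml.
Qed.

(** In the coordinates [T], multiplication by [s] has l1-operator norm at most
    [x], and [phi] reads off the coordinate of [T 0].  Dually, the bound
    [x ^+ r] holds for [phi (s ^+ r * T p)] for all [p], by induction on [r]. *)
Lemma orthogonal_sequence_moment_bound (K : numDomainType) (A : algType K)
    (phi : {scalar A}) (s : A) (T : nat -> A) (c : nat -> K) (x : K) :
    phi 1 = 1 -> T 0%N = 1 -> (forall p, phi (T p.+1) = 0) ->
    (forall p, s * T p = T p.+1 + \sum_(j < p.+1) c j *: T (p - j)%N) ->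
    (forall m, 1 + \sum_(j < m) `|c j| <= x) ->
  forall r, `|phi (s ^+ r)| <= x ^+ r.
Proof.
move=> phi1 T0 phiT sT cx r; rewrite -[s ^+ r]mulr1 -T0.
have x0 : 0 <= x by apply: le_trans (cx 0%N); rewrite big_ord0 addr0 ler01.
elim: r 0%N => [|r IH] p.
  rewrite mul1r expr0; case: p => [|p]; first by rewrite T0 phi1 normr1.
  by rewrite phiT normr0 ler01.
rewrite exprSr -mulrA sT mulrDr linearD/= exprSr.
apply: le_trans (ler_normD _ _) _.
apply: le_trans (ler_wpM2l (exprn_ge0 r x0) (cx p.+1)).
rewrite mulrDr mulr1 lerD// mulr_sumr linear_sum/= mulr_sumr.
apply: le_trans (ler_norm_sum _ _ _) _; apply: ler_sum => j _.
by rewrite -scalerAr linearZ/= normrM mulrC ler_wpM2r.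
Qed.

(** The coefficients [E ('X * P j)] are the free cumulants of [E] of order
    [j.+1]: they are exactly what makes each [P q.+1] centred. *)
Lemma orthogonal_polynomial_sequence (F : comNzRingType)
    (E : {scalar {poly F}}) :
    E 1 = 1 ->
  exists (P : nat -> {poly F}),
    [/\ P 0%N = 1, forall q, E (P q.+1) = 0 &
        forall q, 'X * P q =
          P q.+1 + \sum_(j < q.+1) E ('X * P j) *: P (q - j)%N].
Proof.
move=> E1.
have [|P PE] := @course_of_values {poly F} 0
  (fun q P => if q is q'.+1 then
     'X * P q' - \sum_(j < q) E ('X * P j) *: P (q' - j)%N else 1).
  case=> // q f g fg; rewrite fg//; congr (_ - _).
  by apply: eq_bigr => j _; rewrite !fg// ltnS leq_subr.
have rec q : 'X * P q =
    P q.+1 + \sum_(j < q.+1) E ('X * P j) *: P (q - j)%N.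
  by rewrite [P q.+1]PE subrK.
exists P; split=> //.
(* Applying [E] to the recursion leaves only the term [j = q] of the sum,
   which equals the left-hand side. *)
elim/ltn_ind => q IH.
move: (congr1 E (rec q)); rewrite linearD/= linear_sum/= big_ord_recr/=.
rewrite subnn [P 0%N]PE linearZ/= E1 mulr1 big1 ?add0r => [|j _].
  by rewrite -[X in X = _]add0r => /addIr/esym.
rewrite linearZ/= -(subnSK (ltn_ord j)) IH ?mulr0//.
by rewrite ltn_subrL /= (leq_ltn_trans _ (ltn_ord j)).
Qed.

(** The generating function [f] of [N] solves [f = 1 + L z f + L z f ^+ 2],
    so it converges for [L z] up to [3 - 2 sqrt 2 > 1/6].  At [z = 1 / (6 L)]
    the map [f |-> 1 + f / 6 + f ^+ 2 / 6] sends [[0, 2]] into itself, so the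
    partial sums of [f] stay below 2. *)
Lemma schroeder_majorant (R : realFieldType) (L : R) : 0 < L ->
  exists N : nat -> R,
    [/\ N 0%N = 1, forall q, 0 <= N q,
        forall q, N q.+1 = L * N q + \sum_(j < q.+1) L * N j * N (q - j)%N &
        forall q, N q <= 2 * (6 * L) ^+ q].
Proof.
move=> L0.
have [|N NE] := @course_of_values R 0
  (fun q N => if q is q'.+1 then
     L * N q' + \sum_(j < q) L * N j * N (q' - j)%N else 1).
  case=> // q f g fg; rewrite fg//; congr (_ + _).
  by apply: eq_bigr => j _; rewrite !fg// ltnS leq_subr.
have N0 : N 0%N = 1 by rewrite NE.
have N_ge0 q : 0 <= N q.
  elim/ltn_ind: q => -[|q] IH; first by rewrite N0.
  rewrite NE addr_ge0 ?mulr_ge0 ?IH ?(ltW L0)// sumr_ge0// => j _.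
  by rewrite !mulr_ge0 ?(ltW L0) ?IH// ltnS leq_subr.
pose b q := N q / (6 * L) ^+ q.
have b_ge0 q : 0 <= b q by rewrite divr_ge0// exprn_ge0// mulr_ge0// ltW.
have bS q : b q.+1 = 6^-1 * (b q + \sum_(j < q.+1) b j * b (q - j)%N).
  rewrite {1}/b NE mulrDl mulrDr; congr (_ + _).
    by rewrite /b exprS; field; rewrite ?expf_neq0 ?mulf_neq0 ?gt_eqF.
  rewrite mulr_suml mulr_sumr; apply: eq_bigr => j _.
  have jq : (j <= q)%N by rewrite -ltnS.
  have -> : (6 * L) ^+ q.+1 = 6 * L * ((6 * L) ^+ j * (6 * L) ^+ (q - j)).
    by rewrite -exprD subnKC// exprS.
  rewrite /b.
  by field; rewrite ?expf_neq0 ?mulf_neq0 ?gt_eqF.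
have B m : \sum_(q < m) b q <= 2.
  elim: m => [|m IH]; first by rewrite big_ord0.
  rewrite big_ord_recl /b N0 expr0 divr1 -/(b _).
  have -> : \sum_(i < m) b (bump 0 i) = 6^-1 * (\sum_(q < m) b q +
      \sum_(q < m) \sum_(j < q.+1) b j * b (q - j)%N).
    by rewrite -big_split mulr_sumr; apply: eq_bigr => q _; rewrite bS.
  have S0 : 0 <= \sum_(q < m) b q by apply: sumr_ge0.
  have conv : \sum_(q < m) \sum_(j < q.+1) b j * b (q - j)%N <=
      (\sum_(q < m) b q) ^+ 2.
    case: m {IH} S0 => [|m] S0; first by rewrite !big_ord0 expr0n.
    rewrite (sum_triangle (fun q j => b j * b (q - j)%N)) expr2 mulr_suml.
    apply: ler_sum => j _; rewrite mulr_sumr.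
    have jm : ((m - j).+1 <= m.+1)%N by rewrite ltnS leq_subr.
    rewrite (big_ord_widen _ (fun q => b j * b (q + j - j)%N) jm) big_mkcond/=.
    by apply: ler_sum => q _; rewrite addnK; case: ifP => // _;
      rewrite mulr_ge0.
  have : (\sum_(q < m) b q) ^+ 2 <= 2 ^+ 2 by rewrite lerXn2r// nnegrE.
  move: IH conv; set u := \sum_(q < m) b q; set v := \sum_(q < m) _.
  by move=> *; lra.
exists N; split=> // q.
rewrite -ler_pdivrMr ?exprn_gt0 ?mulr_gt0//; apply: le_trans (B q.+1).
by rewrite big_ord_recr/= lerDr sumr_ge0.
Qed.

(** The sup norms on [[- L, L]] of the polynomials [P q] are majorised by the
    sequence of [schroeder_majorant]. *)
Lemma cumulant_bound (R : realFieldType) (E : {scalar {poly R}})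
    (P : nat -> {poly R}) (L : R) : 0 < L ->
    (forall p c, (forall x, `|x| <= L -> `|p.[x]| <= c) -> `|E p| <= c) ->
    P 0%N = 1 ->
    (forall q, 'X * P q =
      P q.+1 + \sum_(j < q.+1) E ('X * P j) *: P (q - j)%N) ->
  forall q, `|E ('X * P q)| <= (6 * L) ^+ q.+1.
Proof.
move=> L0 EL P0 rec.
have [N [N0 N_ge0 NS N_le]] := @schroeder_majorant R L L0.
have EP q : (forall x, `|x| <= L -> `|(P q).[x]| <= N q) ->
    `|E ('X * P q)| <= L * N q.
  move=> PN; apply: EL => x xL; rewrite hornerM hornerX normrM.
  by apply: ler_pM => //; apply: PN.
have PN q : forall x, `|x| <= L -> `|(P q).[x]| <= N q.
  elim/ltn_ind: q => -[|q] IH x xL; first by rewrite P0 hornerC normr1 N0.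
  have -> : P q.+1 = 'X * P q - \sum_(j < q.+1) E ('X * P j) *: P (q - j)%N.
    by rewrite rec addrK.
  rewrite hornerD hornerN horner_sum NS hornerM hornerX.
  apply: le_trans (ler_normB _ _) _; apply: lerD.
    by rewrite normrM; apply: ler_pM => //; apply: IH.
  apply: le_trans (ler_norm_sum _ _ _) _; apply: ler_sum => j _.
  rewrite hornerZ normrM; apply: ler_pM => //.
    by apply: EP => z; apply: IH.
  by apply: IH => //; rewrite ltnS leq_subr.
move=> q; apply: le_trans (EP q (PN q)) _.
apply: le_trans (ler_wpM2l (ltW L0) (N_le q)) _.
have : 0 <= L * (6 * L) ^+ q by rewrite mulr_ge0 ?exprn_ge0 ?mulr_ge0// ltW.
by rewrite exprS; lra.
Qed.

(** The elements [theta_i ^+ q P_q (X_i)] satisfy the recursion of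
    [free_sum_orthogonal_sequence] with the cumulants of [theta_i X_i], which
    are those of [X_i] multiplied by powers of [theta_i]. *)
Lemma free_weighted_sum_moment_bound (R : realType) (A : tracialNCPSpace R)
    (X : nat -> A) (E : {scalar {poly R}}) (P : nat -> {poly R})
    (n : nat) (theta : 'rV[R]_n) (x : R) :
    free_family X ->
    (forall i p, state (horner_alg (X i) (map_poly (real_complex R) p)) =
                 (E p)%:C%C) ->
    P 0%N = 1 -> (forall q, E (P q.+1) = 0) ->
    (forall q, 'X * P q =
      P q.+1 + \sum_(j < q.+1) E ('X * P j) *: P (q - j)%N) ->
    (forall m, 1 + \sum_(j < m) `|E ('X * P j)| *
                 `|\sum_i theta ord0 i ^+ j.+1| <= x) ->
  forall r, `|state (weighted_sum X theta ^+ r)| <= (x ^+ r)%:C%C.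
Proof.
move=> free EX P0 EP rec xbound r.
pose th i := theta ord0 i.
pose toA i p : A := horner_alg (X i) (map_poly (real_complex R) p).
have toAD i p q : toA i (p + q) = toA i p + toA i q.
  by rewrite /toA !rmorphD.
have toA_sum i m (f : 'I_m -> {poly R}) :
    toA i (\sum_(j < m) f j) = \sum_(j < m) toA i (f j).
  by rewrite /toA raddf_sum linear_sum.
have toAZ i c p : toA i (c *: p) = c%:C%C *: toA i p.
  by rewrite /toA map_polyZ linearZ/= mulr_algl.
have toAX i p : toA i ('X * p) = X i * toA i p.
  by rewrite /toA !rmorphM/= map_polyX horner_algX.
have [|||T [T0 phiT sT]] := @free_sum_orthogonal_sequence R[i] A state n
    (fun i => (th i)%:C%C *: X i) (fun i q => toA i (th i ^+ q *: P q))
    (fun i j => (th i ^+ j.+1 * E ('X * P j))%:C%C).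
- by move=> i; rewrite expr0 scale1r P0 /toA !rmorph1.
- move=> i q.
  rewrite toAZ -scalerAl -scalerAr -toAX rec toAD !toAZ scalerDr scalerDr.
  rewrite scalerA -rmorphM -exprS; congr (_ + _).
  rewrite toA_sum !scaler_sumr; apply: eq_bigr => j _.
  have jq : (j <= q)%N by rewrite -ltnS.
  rewrite !toAZ !scalerA -!rmorphM/=; congr (_%:C%C *: _).
  by rewrite -{1}(subnKC jq) exprD exprS; ring.
- move=> w w0 ws.
  pose f (a : 'I_n * nat) :=
    (a.1 : nat, map_poly (real_complex R) (th a.1 ^+ a.2.+1 *: P a.2.+1)).
  have := free (map f w); rewrite big_map; apply.
  + by case: (w) w0.
  + by rewrite sorted_map; apply: sub_sorted ws.
  + move=> _ /mapP[a _ ->]; rewrite /f /= EX linearZ/= EP mulr0.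
    by rewrite rmorph0.
have := @orthogonal_sequence_moment_bound R[i] A state (weighted_sum X theta) T
  (fun j => \sum_i (th i ^+ j.+1 * E ('X * P j))%:C%C) x%:C%C
  (state1 _) T0 phiT sT.
rewrite rmorphXn; apply => m.
apply: le_trans (_ : (1 + \sum_(j < m) `|E ('X * P j)| *
                 `|\sum_i theta ord0 i ^+ j.+1|)%:C%C <= _); last first.
  by rewrite lecR.
rewrite rmorphD rmorph1 lerD2l rmorph_sum; apply: ler_sum => j _.
rewrite -rmorph_sum -mulr_suml normc_def/= expr0n addr0 sqrtr_sqr normrM mulrC.
by [].
Qed.

(** * Compactly supported laws and their moments *)

(** The complement of the support is covered by the countably many null
    intervals with rational endpoints. *)
Lemma supp_sub_full_measure (R : realType)
    (mu : probability (measurableTypeR R) R) (A : set R) :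
  measurable A -> supp mu `<=` A -> mu A = 1%E.
Proof.
move=> mA suppA.
pose I (k : nat) : set R :=
  if @unpickle (rat * rat)%type k is Some pq
  then `](ratr pq.1 : R), (ratr pq.2 : R)[%classic else set0.
pose N (k : nat) : set R := if mu (I k) == 0%E then I k else set0.
have mI k : measurable (I k) by rewrite /I; case: unpickle.
have cover : ~` A `<=` \bigcup_k N k.
  move=> x Ax.
  have /existsNP[U /not_implyP[oU /not_implyP[Ux /negP]]] : ~ supp mu x.
    by move=> /suppA.
  rewrite -leNgt => muU0.
  have := open_nbhs_nbhs (conj oU Ux) => /nbhs_ballP[e/= e0 xeU].
  have [p /itvP px] : exists p, ratr p \in `]x - e, x[.
    by apply: rat_in_itvoo; rewrite ltrBlDr ltrDl.
  have [q /itvP xq] : exists q, ratr q \in `]x, x + e[.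
    by apply: rat_in_itvoo; rewrite ltrDl.
  have IE : I (pickle (p, q)) = `](ratr p : R), (ratr q : R)[%classic.
    by rewrite /I pickleK.
  exists (pickle (p, q)) => //.
  have IU : `](ratr p : R), (ratr q : R)[%classic `<=` U.
    move=> y /=; rewrite in_itv/= => /andP[py yq]; apply: xeU.
    rewrite /ball/= ltr_distl; apply/andP; split.
      by rewrite ltrBlDr (lt_trans yq)// xq.
    by rewrite -ltrBlDr (lt_trans _ py)// px.
  have mu0 : mu (I (pickle (p, q))) = 0%E.
    apply/eqP; rewrite -measure_le0 IE; apply: le_trans muU0.
    apply: le_measure; [rewrite inE|rewrite inE|exact: IU].
      exact: measurable_itv.
    exact: open_measurable.
  by rewrite /N mu0 eqxx IE/= in_itv/= px xq.
have : mu (~` A) = 0%E.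
  apply/negligibleP; first exact: measurableC.
  apply: (@negligibleS _ (measurableTypeR R) R mu _ _ cover).
  apply: negligible_bigcup => k.
  rewrite /N; case: eqP => [Ik0|_]; last exact: negligible_set0.
  by apply/negligibleP; [exact: mI|exact: Ik0].
move=> A0; rewrite -[A in LHS]setCK probability_setC ?A0 ?sube0//.
exact: measurableC.
Qed.

Section ae_bounded.
Context d (T : measurableType d) (R : realType) (P : probability T R).
Variable D : set T.
Hypotheses (mD : measurable D) (PD : P D = 1%E).

Lemma ae_of_full_measure (Q : T -> Prop) :
  (forall x, D x -> Q x) -> {ae P, forall x, Q x}.
Proof.
move=> DQ; exists (~` D); split; first exact: measurableC.
  by have := probability_setC P mD; rewrite PD subee.
by move=> x /= Qx Dx; apply: Qx; apply: DQ.
Qed.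

Lemma ae_bounded_integral_le (f : T -> R) (c : R) :
  measurable_fun setT f -> (forall x, D x -> `|f x| <= c) ->
  (\int[P]_x `|(f x)%:E| <= c%:E)%E.
Proof.
move=> mf fc.
have [x Dx] : exists x, D x.
  apply/set0P/negP => /eqP D0; move: PD; rewrite D0 measure0 => /eqP.
  by rewrite eq_sym onee_eq0.
have c0 : 0 <= c by apply: le_trans (fc _ Dx).
rewrite -[leRHS]mule1 -(@probability_setT _ _ _ P).
apply: integral_le_bound => //; first exact/measurable_EFinP.
by apply: ae_of_full_measure => y Dy _; rewrite lee_fin fc.
Qed.

Lemma ae_bounded_integrable (f : T -> R) (c : R) :
  measurable_fun setT f -> (forall x, D x -> `|f x| <= c) ->
  P.-integrable setT (EFin \o f).
Proof.
move=> mf fc; apply/integrableP; split; first exact/measurable_EFinP.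
exact: le_lt_trans (ae_bounded_integral_le mf fc) (ltry _).
Qed.

Lemma ae_bounded_Rintegral_le (f : T -> R) (c : R) :
  measurable_fun setT f -> (forall x, D x -> `|f x| <= c) ->
  `|\int[P]_x f x| <= c.
Proof.
move=> mf fc; have intf := ae_bounded_integrable mf fc.
apply: le_trans (le_normr_Rintegral measurableT intf) _.
rewrite -lee_fin fineK; first exact: ae_bounded_integral_le.
apply: integrable_fin_num => //.
by have := integrable_norm intf; apply.
Qed.

End ae_bounded.

Lemma measurable_horner (R : realType) (p : {poly R}) :
  measurable_fun setT (horner p : measurableTypeR R -> R).
Proof. by apply: continuous_measurable_fun => x; exact: continuous_horner. Qed.

Lemma horner_bounded_itv (R : realType) (L : R) (p : {poly R}) :
  exists c : R, forall x : R, `[- L, L]%classic x -> `|p.[x]| <= c.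
Proof.
exists (\sum_(i < size p) `|p`_i| * `|L| ^+ i) => x /=.
rewrite in_itv/= -ler_norml => xL; rewrite horner_coef.
apply: le_trans (ler_norm_sum _ _ _) _; apply: ler_sum => i _.
rewrite normrM normrX ler_wpM2l// lerXn2r ?nnegrE//.
by apply: le_trans xL _; exact: ler_norm.
Qed.

Section compactly_supported.
Context (R : realType) (mu : probability (measurableTypeR R) R) (L : R).
Hypothesis suppL : supp mu `<=` `[- L, L].

Let full : mu `[- L, L]%classic = 1%E.
Proof. exact: supp_sub_full_measure. Qed.

Lemma integrable_horner (p : {poly R}) :
  mu.-integrable setT (EFin \o horner p).
Proof.
have [c pc] := horner_bounded_itv L p.
by apply: ae_bounded_integrable full _ c _ pc => //; exact: measurable_horner.
Qed.

(** Integration is packaged as a linear form on polynomials so that cumulants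
    can be derived from it algebraically. *)
Lemma poly_expectation : exists E : {scalar {poly R}},
  [/\ forall p, E p = \int[mu]_x p.[x], forall k, E 'X^k = moment mu k &
      forall p c, (forall x, `|x| <= L -> `|p.[x]| <= c) -> `|E p| <= c].
Proof.
pose e (p : {poly R}) : R := \int[mu]_x p.[x].
have lin : scalar e.
  move=> c p q; rewrite /e; under eq_Rintegral do rewrite hornerD hornerZ.
  rewrite RintegralD//; last 2 first.
  - have := integrable_horner (c *: p).
    by apply: eq_integrable => // x _ /=; rewrite hornerZ.
  - exact: integrable_horner.
  by rewrite RintegralZl//; exact: integrable_horner.
pose E : {scalar {poly R}} := HB.pack e (GRing.isLinear.Build _ _ _ _ _ lin).
exists E; split => // [k|p c pc].
  by apply: eq_Rintegral => x _; rewrite hornerXn.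
apply: (ae_bounded_Rintegral_le _ full) => //; first exact: measurable_horner.
by move=> x /=; rewrite in_itv/= -ler_norml; exact: pc.
Qed.

(** A set of mass [c] on which [a < `|t|] forces the moment of order [2 k] to
    be at least [c * a ^+ (2 * k)], which outgrows [x ^+ (2 * k)] if [x < a]. *)
Lemma supp_of_moment_growth (x : R) :
  0 <= x -> (forall k, `|moment mu k| <= x ^+ k) -> supp mu `<=` `[- x, x].
Proof.
move=> x0 mx y suppy /=; rewrite in_itv/= -ler_norml leNgt; apply/negP => xy.
pose a := (x + `|y|) / 2.
have [xa ay] : x < a /\ a < `|y| by rewrite /a; split; lra.
have a0 : 0 < a by apply: le_lt_trans xa.
pose U : set R := [set t | a < `|t|].
have oU : open U.
  apply: (@open_comp _ _ (fun t : R => `|t|) [set t | a < t]) => [t _|].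
    exact: norm_continuous.
  exact: open_gt.
have mU : measurable (U : set (measurableTypeR R)) by exact: open_measurable.
have muU : (0 < mu U)%E by apply: suppy.
have fU : mu U \is a fin_num by rewrite fin_num_measure.
pose c := fine (mu U).
have c0 : 0 < c by rewrite fine_gt0// muU ltey_eq fU.
have key k : c <= ((x / a) ^+ 2) ^+ k.
  have ak : 0 < a ^+ (2 * k) by rewrite exprn_gt0.
  rewrite -exprM expr_div_n ler_pdivlMr//.
  apply: le_trans (le_trans (ler_norm _) (mx (2 * k)%N)).
  rewrite -lee_fin /moment fineK; last first.
    apply: integrable_fin_num => //.
    have := integrable_horner 'X^(2 * k).
    by apply: eq_integrable => // t _ /=; rewrite hornerXn.
  pose g : measurableTypeR R -> R := fun t => t ^+ (2 * k).
  have mX : measurable_fun setT (EFin \o g).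
    by apply/measurable_EFinP; exact: exprn_measurable.
  have := le_integral_abse mu measurableT mX ak.
  have g0 t : `|g t| = g t.
    by rewrite ger0_norm// /g exprM exprn_ge0// sqr_ge0.
  rewrite setTI => /(le_trans _) H.
  rewrite (eq_integral (fun t => `|(EFin \o g) t|%E)) => [|t _]; last first.
    by rewrite /= g0.
  apply: H; rewrite EFinM muleC /c fineK// lee_pmul2l// le_measure ?inE//.
    rewrite -[X in measurable X]setTI.
    by apply: emeasurable_fun_c_infty => //; exact: measurableT_comp.
  move=> t /= /ltW at_; rewrite lee_fin normrX lerXn2r// nnegrE//.
  exact: ltW.
have z1 : `|(x / a) ^+ 2| < 1.
  have xa0 : 0 <= x / a by rewrite divr_ge0// ltW.
  by rewrite normrX expr_lt1// ger0_norm// ltr_pdivrMr// mul1r.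
have : c <= 0.
  by apply: (cvgr_to_ge (cvg_expr z1)); apply: nearW => k; exact: key.
by rewrite leNgt c0.
Qed.

End compactly_supported.

(** * Power sums of a uniform point of the sphere *)

Section borel_rV.
Context (R : realType) (n : nat).

Lemma measurable_coord (i : 'I_n) :
  measurable_fun setT (fun v : borel_rV R n => v ord0 i).
Proof.
apply: (measurability _ (RGenOpens.measurableE R)) => _ [_ [a [b ->] <-]].
rewrite setTI; apply: sub_sigma_algebra.
apply: (@open_comp 'rV[R]_n R (fun v => v ord0 i)); last exact: interval_open.
by move=> v _; exact: coord_continuous.
Qed.

Lemma measurable_mulmxr (U : 'M[R]_n) :
  measurable_fun setT (fun v : borel_rV R n => v *m U : borel_rV R n).
Proof.
apply: (@measurability _ _ _ (borel_rV R n) setT _ (@open 'rV[R]_n) erefl).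
move=> _ [A oA <-].
rewrite setTI; apply: sub_sigma_algebra.
apply: (@open_comp 'rV[R]_n 'rV[R]_n (fun v => v *m U)) => // v _ B [P vP PB].
have : nbhs (v : 'rV[R]_n) [set w | forall j, P ord0 j ((w *m U) ord0 j)].
  apply: (@filter_forall _ _ (fun j w => P ord0 j ((w *m U) ord0 j))
            (nbhs (v : 'rV[R]_n))) => j.
  have cts : continuous (fun w : 'rV[R]_n => \sum_k w ord0 k * U k j).
    apply: continuous_big => [|k _ w]; first exact: add_continuous.
    apply: (@cvgM R _ _ _ (fun w : 'rV[R]_n => w ord0 k) (fun=> U k j) _ _
              (@coord_continuous R 1 n ord0 k w)).
    exact: cvg_cst.
  have Pv : nbhs (\sum_k v ord0 k * U k j) (P ord0 j).
    by have := vP ord0 j; rewrite mxE.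
  have := cts v _ Pv; rewrite nbhs_simpl /=.
  by apply: (@filterS _ (nbhs (v : 'rV[R]_n))) => w /=; rewrite mxE.
by apply: filterS => w wP; apply: PB => i j; rewrite (ord1 i).
Qed.

(** A reflection, unlike a rotation, is an involution with a symmetric matrix,
    which together say that it is orthogonal. *)
Lemma plane_reflection (i j : 'I_n) (c s : R) :
    i != j -> c ^+ 2 + s ^+ 2 = 1 ->
  exists2 U : 'M[R]_n, U *m U^T = 1%:M & forall v : 'rV[R]_n,
    (v *m U) ord0 i = c * v ord0 i + s * v ord0 j /\
    (v *m U) ord0 j = s * v ord0 i - c * v ord0 j.
Proof.
move=> ij cs.
pose f (v : 'rV[R]_n) := \row_l (if l == i then c * v ord0 i + s * v ord0 j
   else if l == j then s * v ord0 i - c * v ord0 j else v ord0 l).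
have lin : linear f.
  move=> a u v; apply/rowP => l; rewrite !mxE.
  by case: ifP => _; [ring|case: ifP => _; ring].
pose f' : {linear 'rV[R]_n -> 'rV[R]_n} :=
  HB.pack f (GRing.isLinear.Build _ _ _ _ _ lin).
pose U := lin1_mx f'.
have vU v : v *m U = f v by rewrite mul_rV_lin1.
have ji : (j == i) = false by rewrite eq_sym (negPf ij).
have ff v : f (f v) = v.
  apply/rowP => l; rewrite !mxE !eqxx ji.
  case: eqP => [->|_].
    transitivity ((c ^+ 2 + s ^+ 2) * v ord0 i); first by ring.
    by rewrite cs mul1r.
  case: eqP => [->|//].
  transitivity ((c ^+ 2 + s ^+ 2) * v ord0 j); first by ring.
  by rewrite cs mul1r.
have UU : U *m U = 1%:M.
  by apply/row_matrixP => k; rewrite row_mul !rowE mulmx1 !vU ff.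
have Usym : U^T = U.
  apply/matrixP => k l; rewrite !mxE !eqxx/=.
  have [->|ki] := eqVneq k i; have [->|li] := eqVneq l i => //;
    rewrite ?eqxx ?ji ?(negPf ki) ?(negPf li) ?(negPf ij) //=.
  - by rewrite [j == l]eq_sym; case: eqP => _ /=; ring.
  - by rewrite [j == k]eq_sym; case: eqP => _ /=; ring.
  - have [kj|kj] := eqVneq k j; have [lj|lj] := eqVneq l j => /=;
      rewrite ?kj ?lj ?mulr0 ?subr0 ?eqxx//.
    + by rewrite (negPf lj).
    + by rewrite (negPf kj).
    + by rewrite eq_sym.
exists U; first by rewrite Usym.
by move=> v; rewrite vU !mxE !eqxx ji.
Qed.

End borel_rV.

Section uniform_expectation.
Context (R : realType) (n : nat) (sigma : probability (borel_rV R n) R).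
Hypothesis unif : uniform_on_sphere sigma.

Lemma measurable_sphere : measurable (@sphere R n : set (borel_rV R n)).
Proof.
have -> : (@sphere R n : set (borel_rV R n)) =
    (fun v : borel_rV R n => \sum_i v ord0 i ^+ 2) @^-1` [set 1] by [].
rewrite -[X in measurable X]setTI; apply: (_ : measurable_fun setT _) => //.
by apply: measurable_sum => i; apply: measurable_funX; exact: measurable_coord.
Qed.

(** The class of functions to which [mean] below is applied; unlike
    integrability it is closed under products. *)
Definition sphere_bounded (f : borel_rV R n -> R) :=
  measurable_fun setT f /\
  exists c, forall v : borel_rV R n, sphere v -> `|f v| <= c.

Lemma sphere_bounded_cst a : sphere_bounded (fun=> a).
Proof. by split=> //; exists `|a|. Qed.

Lemma sphere_bounded_coord i : sphere_bounded (fun v => v ord0 i).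
Proof.
split; first exact: measurable_coord.
exists 1 => v; rewrite /sphere/= (bigD1 i)//= => v1.
rewrite -(@expr_le1 _ 2)// real_normK ?num_real//.
by rewrite -v1 lerDl sumr_ge0// => k _; rewrite sqr_ge0.
Qed.

Lemma sphere_boundedD f g : sphere_bounded f -> sphere_bounded g ->
  sphere_bounded (fun v => f v + g v).
Proof.
move=> [mf [c fc]] [mg [d gd]]; split; first exact: measurable_funD.
exists (c + d) => v sv; apply: le_trans (ler_normD _ _) _.
by rewrite lerD ?fc ?gd.
Qed.

Lemma sphere_boundedM f g : sphere_bounded f -> sphere_bounded g ->
  sphere_bounded (fun v => f v * g v).
Proof.
move=> [mf [c fc]] [mg [d gd]]; split; first exact: measurable_funM.
by exists (c * d) => v sv; rewrite normrM ler_pM ?fc ?gd.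
Qed.

Lemma sphere_boundedX f k : sphere_bounded f ->
  sphere_bounded (fun v => f v ^+ k).
Proof.
move=> bf; elim: k => [|k IH]; first exact: sphere_bounded_cst.
by under eq_fun do rewrite exprS; exact: sphere_boundedM.
Qed.

Lemma sphere_bounded_sum (I : Type) (r : seq I) (f : I -> borel_rV R n -> R) :
  (forall i, sphere_bounded (f i)) ->
  sphere_bounded (fun v => \sum_(i <- r) f i v).
Proof.
move=> bf; elim: r => [|i r IH].
  by under eq_fun do rewrite big_nil; exact: sphere_bounded_cst.
by under eq_fun do rewrite big_cons; exact: sphere_boundedD.
Qed.

Definition mean (f : borel_rV R n -> R) : R := \int[sigma]_v f v.

Lemma sphere_bounded_integrable f : sphere_bounded f ->
  sigma.-integrable setT (EFin \o f).
Proof.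
move=> [mf [c fc]].
exact: (ae_bounded_integrable measurable_sphere unif.1 mf fc).
Qed.

Lemma eq_mean f g : sphere_bounded f -> sphere_bounded g ->
  (forall v, sphere v -> f v = g v) -> mean f = mean g.
Proof.
move=> bf bg fg; apply/eqP; rewrite -subr_eq0 -normr_le0 /mean -RintegralB//;
  try exact: sphere_bounded_integrable.
apply: (ae_bounded_Rintegral_le measurable_sphere unif.1).
  by apply: measurable_funB; [exact: bf.1|exact: bg.1].
by move=> v sv; rewrite fg// subrr normr0.
Qed.

Lemma meanD f g : sphere_bounded f -> sphere_bounded g ->
  mean (fun v => f v + g v) = mean f + mean g.
Proof.
by move=> bf bg; rewrite /mean RintegralD//; exact: sphere_bounded_integrable.
Qed.

Lemma meanZ a f : sphere_bounded f -> mean (fun v => a * f v) = a * mean f.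
Proof.
by move=> bf; rewrite /mean RintegralZl//; exact: sphere_bounded_integrable.
Qed.

Lemma mean_cst a : mean (fun=> a) = a.
Proof.
rewrite /mean Rintegral_cst//.
by rewrite [X in fine X](probability_setT sigma) mulr1.
Qed.

Lemma mean_sum (I : Type) (r : seq I) (f : I -> borel_rV R n -> R) :
  (forall i, sphere_bounded (f i)) ->
  mean (fun v => \sum_(i <- r) f i v) = \sum_(i <- r) mean (f i).
Proof.
move=> bf; elim: r => [|i r IH].
  by under eq_fun do rewrite big_nil; rewrite mean_cst big_nil.
under eq_fun do rewrite big_cons.
by rewrite meanD ?IH ?big_cons//; exact: sphere_bounded_sum.
Qed.

(** Change of variables: the image of [sigma] under [U] agrees with [sigma] on
    measurable sets. *)
Lemma mean_orthogonal (U : 'M[R]_n) (f : borel_rV R n -> R) :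
  U *m U^T = 1%:M -> sphere_bounded f ->
  mean (fun v => f (v *m U)) = mean f.
Proof.
move=> UU bf; have [mf [c fc]] := bf.
pose phi : borel_rV R n -> borel_rV R n := fun v => v *m U.
have mphi : measurable_fun setT phi := measurable_mulmxr U.
have normE (v : 'rV[R]_n) : \sum_i v ord0 i ^+ 2 = (v *m v^T) ord0 ord0.
  by rewrite mxE; apply: eq_bigr => i _; rewrite mxE expr2.
have bphi : sphere_bounded (f \o phi).
  split; first exact: measurableT_comp.
  exists c => v; rewrite /sphere/= normE => sv; apply: fc.
  by rewrite /sphere/= normE /phi trmx_mul mulmxA -(mulmxA v) UU mulmx1.
rewrite /mean /Rintegral; congr fine.
have mfE : measurable_fun setT (EFin \o f) by exact/measurable_EFinP.
have := integral_pushforward mphi mfE (sphere_bounded_integrable bphi)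
  measurableT.
rewrite /= => <-.
pose push : {measure set (borel_rV R n) -> \bar R} := pushforward sigma phi.
apply: (@eq_measure_integral _ _ _ _ sigma (push mphi)) => A mA _.
by rewrite /push/= /pushforward/=; apply: unif.2.
Qed.

Ltac sphere_bounded_tac := repeat first
  [ exact: sphere_bounded_coord | exact: sphere_bounded_cst
  | apply: sphere_bounded_sum => ? | apply: sphere_boundedX
  | apply: sphere_boundedD | apply: sphere_boundedM ].

Lemma mean_plane_reflection (i j : 'I_n) (c s : R) (g : R -> R -> R) :
  i != j -> c ^+ 2 + s ^+ 2 = 1 ->
  sphere_bounded (fun v => g (v ord0 i) (v ord0 j)) ->
  mean (fun v => g (c * v ord0 i + s * v ord0 j) (s * v ord0 i - c * v ord0 j))
  = mean (fun v => g (v ord0 i) (v ord0 j)).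
Proof.
move=> ij cs bg; have [U UU vU] := plane_reflection ij cs.
rewrite -(mean_orthogonal UU bg); congr mean; apply/funext => v.
by rewrite (vU v).1 (vU v).2.
Qed.

(** [mean_plane_reflection] for [c = s = 1 / sqrt 2].  Stating the expansion of
    [g] for every [s] with [s ^+ 2 = 2^-1] keeps the square root out of the
    polynomial identities. *)
Lemma mean_quarter_turn (i j : 'I_n) (g h : R -> R -> R) :
  i != j ->
  sphere_bounded (fun v => g (v ord0 i) (v ord0 j)) ->
  (forall s x y, s ^+ 2 = 2^-1 -> g (s * x + s * y) (s * x - s * y) = h x y) ->
  mean (fun v => h (v ord0 i) (v ord0 j)) =
  mean (fun v => g (v ord0 i) (v ord0 j)).
Proof.
move=> ij bg gh.
have s2 : Num.sqrt (2^-1 : R) ^+ 2 = 2^-1 by rewrite sqr_sqrtr// invr_ge0.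
rewrite -(@mean_plane_reflection i j (Num.sqrt 2^-1) (Num.sqrt 2^-1) g)//.
  by congr mean; apply/funext => v; rewrite gh.
by rewrite s2; lra.
Qed.

(** Invariance of the mean of [x ^+ 4 + y ^+ 4] under [mean_quarter_turn]. *)
Lemma mean_deg4 (i j : 'I_n) : i != j ->
  mean (fun v => v ord0 i ^+ 4) + mean (fun v => v ord0 j ^+ 4) =
  6 * mean (fun v => v ord0 i ^+ 2 * v ord0 j ^+ 2).
Proof.
move=> ij.
have := @mean_quarter_turn i j (fun x y => x ^+ 4 + y ^+ 4)
  (fun x y => 2^-1 * (x ^+ 4 + y ^+ 4) + 3 * (x ^+ 2 * y ^+ 2)) ij.
rewrite /= meanD ?meanZ ?meanD; try by sphere_bounded_tac.
move=> /(_ _ _)/wrap[||]; first by sphere_bounded_tac.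
  move=> s x y s2; transitivity
    ((s ^+ 2) ^+ 2 * (2 * (x ^+ 4 + y ^+ 4) + 12 * (x ^+ 2 * y ^+ 2))).
    by ring.
  by rewrite s2; field.
by lra.
Qed.

Lemma mean_deg6 (i j : 'I_n) : i != j ->
  mean (fun v => v ord0 i ^+ 6) + mean (fun v => v ord0 j ^+ 6) =
  5 * (mean (fun v => v ord0 i ^+ 4 * v ord0 j ^+ 2) +
       mean (fun v => v ord0 j ^+ 4 * v ord0 i ^+ 2)).
Proof.
move=> ij.
have := @mean_quarter_turn i j (fun x y => x ^+ 6 + y ^+ 6)
  (fun x y => 4^-1 * (x ^+ 6 + y ^+ 6) +
              15 / 4 * (x ^+ 4 * y ^+ 2 + y ^+ 4 * x ^+ 2)) ij.
rewrite /= meanD ?meanZ ?meanD; try by sphere_bounded_tac.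
move=> /(_ _ _)/wrap[||]; first by sphere_bounded_tac.
  move=> s x y s2; transitivity
    ((s ^+ 2) ^+ 3 * (2 * (x ^+ 6 + y ^+ 6) +
       30 * (x ^+ 4 * y ^+ 2 + y ^+ 4 * x ^+ 2))).
    by ring.
  by rewrite s2; field.
by lra.
Qed.

(** Changing the sign of one coordinate changes the sign of the integrand. *)
Lemma mean_odd (i j : 'I_n) : i != j ->
  mean (fun v => v ord0 i ^+ 3 * v ord0 j ^+ 3) = 0.
Proof.
move=> ij.
have := @mean_plane_reflection i j (- 1) 0 (fun x y => x ^+ 3 * y ^+ 3) ij.
move=> /(_ _ _)/wrap[||]; first by ring.
  by sphere_bounded_tac.
under eq_fun => v.
  have -> : (-1 * v ord0 i + 0 * v ord0 j) ^+ 3 *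
     (0 * v ord0 i - -1 * v ord0 j) ^+ 3 =
     -1 * (v ord0 i ^+ 3 * v ord0 j ^+ 3) by ring.
  over.
rewrite /= meanZ; last by sphere_bounded_tac.
by lra.
Qed.

Let M4 := \sum_i mean (fun v => v ord0 i ^+ 4).
Let M6 := \sum_i mean (fun v => v ord0 i ^+ 6).

Lemma sum_diag (f : 'I_n -> R) :
  \sum_i \sum_j (i == j)%:R * f i = \sum_i f i.
Proof.
apply: eq_bigr => i _; rewrite (bigD1 i)//= eqxx mul1r big1 ?addr0// => j ji.
by rewrite eq_sym (negPf ji) mul0r.
Qed.

(** Sum [mean_deg4] over all pairs [(i, j)] and use that the squares of the
    coordinates add up to 1. *)
Lemma sum_mean_deg4 : (n%:R + 2) * M4 = 3.
Proof.
have one : \sum_i \sum_j mean (fun v => v ord0 i ^+ 2 * v ord0 j ^+ 2) = 1.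
  rewrite -(mean_cst 1).
  have -> : mean (fun=> 1) =
      mean (fun v => \sum_i \sum_j v ord0 i ^+ 2 * v ord0 j ^+ 2).
    apply: eq_mean; [exact: sphere_bounded_cst| by sphere_bounded_tac|].
    move=> v; rewrite /sphere/= => v1.
    under eq_bigr do rewrite -mulr_sumr.
    by rewrite -mulr_suml v1 mulr1.
  rewrite mean_sum; last by move=> i; sphere_bounded_tac.
  apply: eq_bigr => i _; rewrite mean_sum// => j.
  by sphere_bounded_tac.
(* On the diagonal the relation fails by [4 x_i ^+ 4], whence the last term. *)
have pair (i j : 'I_n) :
    6 * mean (fun v => v ord0 i ^+ 2 * v ord0 j ^+ 2) =
    mean (fun v => v ord0 i ^+ 4) + mean (fun v => v ord0 j ^+ 4) +
    (i == j)%:R * (4 * mean (fun v => v ord0 i ^+ 4)).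
  have [<-|ij] := eqVneq i j; last by rewrite mul0r addr0 mean_deg4.
  by under eq_fun do rewrite -exprD; rewrite mul1r; ring.
have : 6 * 1 = n%:R * M4 + n%:R * M4 + 4 * M4.
  rewrite -[X in 6 * X]one mulr_sumr; under eq_bigr do rewrite mulr_sumr.
  under eq_bigr do (under eq_bigr do rewrite pair).
  under eq_bigr do rewrite !big_split/=.
  rewrite !big_split/= sum_diag -mulr_sumr -/M4; congr (_ + _ + _).
    by under eq_bigr do rewrite sumr_const card_ord; rewrite sumrMnl mulr_natl.
  by rewrite sumr_const card_ord mulr_natl.
by lra.
Qed.

(** As for [sum_mean_deg4], with the [x_j ^+ 2] summed out in
    [x_i ^+ 4 * x_j ^+ 2]. *)
Lemma sum_mean_deg6 : (n%:R + 4) * M6 = 5 * M4.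
Proof.
have one (i : 'I_n) : \sum_j mean (fun v => v ord0 i ^+ 4 * v ord0 j ^+ 2) =
    mean (fun v => v ord0 i ^+ 4).
  rewrite -mean_sum; last by move=> j; sphere_bounded_tac.
  apply: eq_mean; [by sphere_bounded_tac| by sphere_bounded_tac|].
  by move=> v; rewrite /sphere/= => v1; rewrite -mulr_sumr v1 mulr1.
(* On the diagonal the relation fails by [8 x_i ^+ 6]. *)
have pair (i j : 'I_n) :
    5 * (mean (fun v => v ord0 i ^+ 4 * v ord0 j ^+ 2) +
         mean (fun v => v ord0 j ^+ 4 * v ord0 i ^+ 2)) =
    mean (fun v => v ord0 i ^+ 6) + mean (fun v => v ord0 j ^+ 6) +
    (i == j)%:R * (8 * mean (fun v => v ord0 i ^+ 6)).
  have [<-|ij] := eqVneq i j; last by rewrite mul0r addr0 mean_deg6.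
  by under eq_fun do rewrite -exprD; rewrite mul1r; ring.
have : 5 * (M4 + M4) = n%:R * M6 + n%:R * M6 + 8 * M6.
  have -> : M4 + M4 =
    \sum_i \sum_j (mean (fun v => v ord0 i ^+ 4 * v ord0 j ^+ 2) +
                   mean (fun v => v ord0 j ^+ 4 * v ord0 i ^+ 2)).
    under eq_bigr do rewrite big_split/=.
    rewrite big_split/= [X in _ = _ + X]exchange_big/=.
    by under eq_bigr do rewrite one.
  rewrite mulr_sumr; under eq_bigr do rewrite mulr_sumr.
  under eq_bigr do (under eq_bigr do rewrite pair).
  under eq_bigr do rewrite !big_split/=.
  rewrite !big_split/= sum_diag -mulr_sumr -/M6; congr (_ + _ + _).
    by under eq_bigr do rewrite sumr_const card_ord; rewrite sumrMnl mulr_natl.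
  by rewrite sumr_const card_ord mulr_natl.
by lra.
Qed.

Lemma mean_cube_sum_sq : mean (fun v => (\sum_i v ord0 i ^+ 3) ^+ 2) = M6.
Proof.
under eq_fun => v.
  rewrite expr2 mulr_suml; under eq_bigr do rewrite mulr_sumr.
  over.
rewrite /= mean_sum; last by move=> i; sphere_bounded_tac.
apply: eq_bigr => i _; rewrite mean_sum; last by move=> j; sphere_bounded_tac.
rewrite (bigD1 i)//= big1 ?addr0 => [|j ji]; last by rewrite mean_odd// eq_sym.
by under eq_fun do rewrite -exprD.
Qed.

(** One quantity that controls both power sums, normalised to have a bounded
    mean. *)
Definition coefficient_size (v : borel_rV R n) : R :=
  n%:R * (\sum_i v ord0 i ^+ 4) + n%:R ^+ 2 * (\sum_i v ord0 i ^+ 3) ^+ 2.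

Lemma sphere_bounded_size : sphere_bounded coefficient_size.
Proof. by rewrite /coefficient_size; sphere_bounded_tac. Qed.

(** The two means are at most [3 n / (n + 2) <= 3] and
    [15 n ^+ 2 / ((n + 2) (n + 4)) <= 15]. *)
Lemma mean_size : mean coefficient_size <= 18.
Proof.
rewrite /coefficient_size meanD ?meanZ; try by sphere_bounded_tac.
rewrite mean_cube_sum_sq mean_sum; last by move=> i; sphere_bounded_tac.
rewrite -/M4; have := sum_mean_deg4; have := sum_mean_deg6.
have n0 : 0 <= n%:R :> R by [].
have Q0 : 0 <= M4.
  by apply: sumr_ge0 => i _; apply: Rintegral_ge0 => v _;
    rewrite (exprM _ 2 2) sqr_ge0.
have S0 : 0 <= M6.
  by apply: sumr_ge0 => i _; apply: Rintegral_ge0 => v _;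
    rewrite (exprM _ 3 2) sqr_ge0.
move: n0 Q0 S0; move: (n%:R : R) => N n0 Q0 S0 e6 e4.
by nra.
Qed.

Lemma measurable_small_coefficients (t : R) :
  measurable
    ([set v | sphere v /\ coefficient_size v <= t] : set (borel_rV R n)).
Proof.
apply: measurableI; first exact: measurable_sphere.
rewrite -[X in measurable X]setTI.
have [mh _] := sphere_bounded_size.
by have := mh measurableT _ (measurable_itv `]-oo, t]); rewrite setTI.
Qed.

Lemma size_markov (t : R) : 0 < t ->
  ((1 - 18 / t)%:E <=
   sigma [set v | sphere v /\ (coefficient_size v <= t)%R])%E.
Proof.
move=> t0.
have [mh _] := sphere_bounded_size.
have h0 v : 0 <= coefficient_size v.
  apply: addr_ge0; apply: mulr_ge0; rewrite ?sqr_ge0//.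
  by apply: sumr_ge0 => i _; rewrite (exprM _ 2 2) sqr_ge0.
have mhE : measurable_fun setT (EFin \o coefficient_size).
  exact/measurable_EFinP.
pose B := [set v | (t%:E <= `|(EFin \o coefficient_size) v|)%E].
have mB : measurable (B : set (borel_rV R n)).
  rewrite -[X in measurable X]setTI.
  by apply: emeasurable_fun_c_infty => //; exact: measurableT_comp.
have tB : (t%:E * sigma B <= 18%:E)%E.
  have := le_integral_abse sigma measurableT mhE t0.
  rewrite setTI => /le_trans; apply.
  rewrite (eq_integral (EFin \o coefficient_size)) => [|u _]; last first.
    by rewrite /= (ger0_norm (h0 u)).
  rewrite -[leLHS]fineK; last first.
    apply: integrable_fin_num => //.
    exact: sphere_bounded_integrable sphere_bounded_size.
  by rewrite lee_fin mean_size.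
have sB : (sigma B <= (18 / t)%:E)%E by rewrite EFinM muleC lee_pdivlMl.
have mF := measurable_small_coefficients t.
have cover : @sphere R n `\` B `<=`
    [set v | sphere v /\ coefficient_size v <= t].
  move=> v [sv /negP]; rewrite /B/= -ltNge ger0_norm// lte_fin => /ltW vt.
  by split.
have mS := measurable_sphere.
have mSB : measurable (@sphere R n `\` B : set (borel_rV R n)).
  exact: measurableD.
rewrite EFinB leeBlDr//.
apply: (@le_trans _ _ (sigma (@sphere R n `\` B) + sigma B)%E).
  rewrite -[leLHS]unif.1; apply: le_trans (measureU2 _ mSB mB).
  apply: le_measure; rewrite ?inE//; first exact: measurableU.
  by move=> v sv; have [Bv|Bv] := pselect (B v); [right|left].
by apply: leeD => //; apply: le_measure; rewrite ?inE.
Qed.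

End uniform_expectation.

(** * The support of a weighted free sum *)

(** For [12 L |theta_i| <= 1] and [B = 6 L], each power of [theta_i] beyond the
    fourth costs a factor [1 / 2], so the tail is a geometric series. *)
Lemma cumulant_tail (R : realFieldType) (n : nat) (theta : 'I_n -> R)
    (k : nat -> R) (B : R) : 0 <= B ->
    (forall j, `|k j| <= B ^+ j.+1) ->
    (forall i, B * `|theta i| <= 2^-1) ->
  forall m, \sum_(j < m) `|k j.+3| * `|\sum_i theta i ^+ j.+4| <=
    2 * B ^+ 4 * \sum_i theta i ^+ 4.
Proof.
move=> B0 kB thB m.
set Q := \sum_i theta i ^+ 4.
have Q0 : 0 <= B ^+ 4 * Q.
  rewrite mulr_ge0 ?exprn_ge0// sumr_ge0// => i _.
  by rewrite (exprM _ 2 2) sqr_ge0.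
have term j : `|k j.+3| * `|\sum_i theta i ^+ j.+4| <= B ^+ 4 * Q * 2^-1 ^+ j.
  apply: (@le_trans _ _ (B ^+ j.+4 * \sum_i `|theta i| ^+ j.+4)).
    apply: ler_pM => //; apply: le_trans (ler_norm_sum _ _ _) _.
    by under eq_bigr do rewrite normrX.
  rewrite /Q !mulr_sumr mulr_suml.
  apply: ler_sum => i _.
  have -> : B ^+ j.+4 * `|theta i| ^+ j.+4 =
      (B * `|theta i|) ^+ j * (B ^+ 4 * `|theta i| ^+ 4).
    by rewrite -!exprMn -exprD addn4.
  rewrite -[`|theta i| ^+ 4]normrX [`|theta i ^+ 4|]ger0_norm; last first.
    by rewrite (exprM _ 2 2) sqr_ge0.
  rewrite mulrC; apply: ler_wpM2l.
    by apply: mulr_ge0; [exact: exprn_ge0|rewrite (exprM _ 2 2) sqr_ge0].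
  by rewrite lerXn2r ?nnegrE ?mulr_ge0.
apply: (@le_trans _ _ (\sum_(j < m) B ^+ 4 * Q * 2^-1 ^+ j)).
  by apply: ler_sum => j _; exact: term.
have geo : \sum_(j < m) (2^-1 : R) ^+ j <= 2.
  have -> : \sum_(j < m) (2^-1 : R) ^+ j = 2 - 2 * 2^-1 ^+ m.
    elim: m => [|m IH]; first by rewrite big_ord0 expr0; ring.
    by rewrite big_ord_recr/= IH exprS; field.
  by rewrite gerBl mulr_ge0// exprn_ge0.
rewrite -mulr_sumr; apply: le_trans (ler_wpM2l Q0 geo) _.
by rewrite mulrC mulrA.
Qed.

Lemma state_horner (R : realType) (A : tracialNCPSpace R) (x : A)
    (mu : probability (measurableTypeR R) R) (E : {scalar {poly R}}) :
    has_distribution x mu -> (forall k, E 'X^k = moment mu k) ->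
  forall p, state (horner_alg x (map_poly (real_complex R) p)) = (E p)%:C%C.
Proof.
move=> [_ xmu] EX p; rewrite -[p]coefK poly_def.
rewrite raddf_sum linear_sum linear_sum/= [X in X%:C%C]linear_sum rmorph_sum.
apply: eq_bigr => i _.
rewrite map_polyZ map_polyXn !linearZ/= mulr_algl linearZ/= EX.
by rewrite rmorphXn/= horner_algX xmu rmorphM.
Qed.

Lemma low_cumulants (R : comNzRingType) (E : {scalar {poly R}})
    (P : nat -> {poly R}) :
    P 0%N = 1 ->
    (forall q, 'X * P q =
      P q.+1 + \sum_(j < q.+1) E ('X * P j) *: P (q - j)%N) ->
    E 1 = 1 -> E 'X = 0 -> E 'X^2 = 1 ->
  [/\ E ('X * P 0%N) = 0, E ('X * P 1%N) = 1 & E ('X * P 2%N) = E 'X^3].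
Proof.
move=> P0 rec E1 EX EX2.
have P1 : P 1%N = 'X.
  have := rec 0%N; rewrite big_ord1 P0 mulr1 EX scale0r addr0 => ->.
  by [].
have P2 : P 2%N = 'X^2 - 1.
  have := rec 1%N; rewrite big_ord_recr big_ord1/= P0 P1 mulr1 EX scale0r add0r.
  by rewrite -expr2 EX2 scale1r => ->; rewrite addrK.
rewrite P0 P1 P2 mulr1 -expr2 mulrBr mulr1 -exprS linearB/= EX subr0.
by split.
Qed.

(** In [1 + sum_j |K_j|] the terms [j = 0, 1, 2] are [0], [1] and the
    third-moment term; the others are estimated by [cumulant_tail]. *)
Lemma free_weighted_sum_supp (R : realType)
    (mu mu_theta : probability (measurableTypeR R) R) (A : tracialNCPSpace R)
    (X : nat -> A) (M : R) (n : nat) (theta : 'rV[R]_n) :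
    0 < M -> supp mu `<=` `[- M, M] -> moment mu 1 = 0 -> moment mu 2 = 1 ->
    (forall i, has_distribution (X i) mu) -> free_family X ->
    sphere theta -> (forall i, 12 * M * `|theta ord0 i| <= 1) ->
    has_distribution (weighted_sum X theta) mu_theta ->
  let x := 2 + `|moment mu 3| * `|\sum_i theta ord0 i ^+ 3| +
           2 * (6 * M) ^+ 4 * \sum_i theta ord0 i ^+ 4 in
  supp mu_theta `<=` `[- x, x].
Proof.
move=> M0 suppM mu1 mu2 Xmu free sth thM [[M' suppM'] Smu] x.
have [E [_ EX Ebound]] := poly_expectation suppM.
have E1 : E 1 = 1.
  have := EX 0%N; rewrite expr0 => ->.
  rewrite /moment; under eq_Rintegral do rewrite expr0.
  by rewrite Rintegral_cst// [X in fine X](probability_setT mu) mulr1.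
have [P [P0 EP rec]] := orthogonal_polynomial_sequence E1.
have kB := cumulant_bound M0 Ebound P0 rec.
have [||k0 k1 k2] := low_cumulants P0 rec E1.
- by have := EX 1%N; rewrite expr1 mu1.
- by rewrite EX.
pose g j := `|E ('X * P j)| * `|\sum_i theta ord0 i ^+ j.+1|.
have g_ge0 j : 0 <= g j by rewrite mulr_ge0.
have xbound m : 1 + \sum_(j < m) g j <= x.
  (* Longer sums are larger, so the first three terms may be assumed present. *)
  apply: (@le_trans _ _ (1 + \sum_(j < m.+3) g j)).
    rewrite lerD2l (big_ord_widen m.+3 g (leqW (leqW (leqnSn m)))) big_mkcond/=.
    by apply: ler_sum => j _; case: ifP.
  rewrite !big_ord_recl/= {1}/g k0 normr0 mul0r add0r.
  rewrite {1}/g k1 normr1 mul1r {1}/g k2 EX sth normr1.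
  have := @cumulant_tail R n (theta ord0) (fun j => E ('X * P j)) (6 * M)
    _ kB _ m.
  rewrite mulr_ge0 ?(ltW M0)// => /(_ isT) H.
  have {H} tail : \sum_(i < m) g i.+3 <=
      2 * (6 * M) ^+ 4 * \sum_i theta ord0 i ^+ 4.
    by apply: H => i; have := thM i; lra.
  change (1 + (1 + (`|moment mu 3| * `|\sum_i theta ord0 i ^+ 3| +
    \sum_(i < m) g i.+3)) <= x).
  by rewrite /x; lra.
have x0 : 0 <= x by apply: le_trans (xbound 0%N); rewrite big_ord0 addr0.
apply: (supp_of_moment_growth suppM' x0) => r.
have := @free_weighted_sum_moment_bound R A X E P n theta x free _ P0 EP rec
  xbound r.
rewrite Smu normc_def/= expr0n addr0 sqrtr_sqr lecR; apply => i p.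
exact: state_horner.
Qed.

(** The fourth power sum controls each single coefficient, so for [n] large
    compared with [t * L ^+ 4] all coefficients meet the smallness condition of
    [free_weighted_sum_supp]. *)
Lemma small_coefficients (R : realFieldType) (n : nat) (theta : 'I_n -> R)
    (t L : R) :
    1 <= t -> 0 < L -> t * (12 * L) ^+ 4 <= n%:R -> (0 < n)%N ->
    n%:R * (\sum_i theta i ^+ 4) + n%:R ^+ 2 * (\sum_i theta i ^+ 3) ^+ 2
      <= t ->
  [/\ \sum_i theta i ^+ 4 <= t / n%:R, `|\sum_i theta i ^+ 3| <= t / n%:R &
      forall i, 12 * L * `|theta i| <= 1].
Proof.
move=> t1 L0 tn n_gt0 size_le.
have n0 : 0 < n%:R :> R by rewrite ltr0n.
have th4 i : 0 <= theta i ^+ 4 by rewrite (exprM _ 2 2) sqr_ge0.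
have Q0 : 0 <= \sum_i theta i ^+ 4 by apply: sumr_ge0.
have Q_le : n%:R * (\sum_i theta i ^+ 4) <= t.
  by apply: le_trans size_le; rewrite lerDl mulr_ge0 ?sqr_ge0// exprn_ge0// ltW.
have K_le : (n%:R * \sum_i theta i ^+ 3) ^+ 2 <= t.
  by apply: le_trans size_le; rewrite exprMn lerDr mulr_ge0// ltW.
split=> [||i].
- by rewrite ler_pdivlMr// mulrC.
- rewrite ler_pdivlMr// mulrC -[X in X * _](gtr0_norm n0) -normrM.
  rewrite -(@ler_pXn2r _ 2)// ?nnegrE ?(le_trans ler01 t1)//.
  rewrite real_normK ?num_real//; apply: le_trans K_le _.
  by rewrite expr2 ler_peMl// (le_trans ler01 t1).
- rewrite -(@expr_le1 _ 4)//; last by rewrite !mulr_ge0// ltW.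
  rewrite exprMn -normrX ger0_norm//.
  have ti : n%:R * theta i ^+ 4 <= t.
    apply: le_trans Q_le; rewrite ler_pM2l// (bigD1 i)//= lerDl.
    by apply: sumr_ge0.
  rewrite -(ler_pM2l n0) mulrCA mulr1; apply: le_trans tn.
  rewrite [t * _]mulrC; apply: ler_wpM2l => //.
  by rewrite exprn_ge0// mulr_ge0// ltW.
Qed.

Lemma moments12_of_mean_variance (R : realType)
    (mu : probability (measurableTypeR R) R) :
  ('E_mu[@idfun R] = 0)%E -> ('V_mu[@idfun R] = 1)%E ->
  moment mu 1 = 0 /\ moment mu 2 = 1.
Proof.
move=> Emu Vmu; split.
  move: Emu; rewrite unlock /moment /Rintegral => Emu.
  by under eq_integral do rewrite expr1; rewrite Emu.
move: Vmu; rewrite /variance covariance.unlock Emu/= expectation.unlock.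
rewrite /moment /Rintegral => Vmu.
rewrite (_ : \int[mu]_x (x ^+ 2)%:E = 1)%E//.
rewrite -Vmu; apply: eq_integral => x _ /=.
by rewrite fctE/= !subr0 expr2.
Qed.

Unset Implicit Arguments.
Set Strict Implicit.

Theorem theorem1p6 (R : realType) (rho : R) (hrho : 0 < rho < 1) :
  exists2 C : R, 0 < C &
  forall mu : probability (measurableTypeR R) R,
    ('E_mu[@idfun R] = 0)%E ->
    ('V_mu[@idfun R] = 1)%E ->
  exists n0 : nat,
  forall L : R, 0 < L -> supp mu `<=` `[- L, L] ->
  forall (A : tracialNCPSpace R) (X : nat -> A),
    (forall i, selfadjoint (X i)) ->
    (forall i, bounded_rv (X i)) ->
    (forall i, has_distribution (X i) mu) ->
    free_family X ->
  exists F : forall n : nat, set (borel_rV R n),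
    (forall n, [/\ measurable (F n),
                   F n `<=` @sphere R n &
                   forall sigma : probability (borel_rV R n) R,
                     uniform_on_sphere sigma ->
                     ((1 - rho)%:E <= sigma (F n))%E]) /\
    (forall n (theta : 'rV[R]_n), (n0 <= n)%N -> F n theta ->
     forall mu_theta : probability (measurableTypeR R) R,
       has_distribution (weighted_sum X theta) mu_theta ->
       let r := C * (768 * L ^+ 4 + 6 * `|moment mu 3|) / n%:R in
       supp mu_theta `<=` `](- 2 - r), (2 + r)[).
Proof.
have /andP[rho0 rho1] := hrho.
pose t := 18 / rho.
have t0 : 0 < t by rewrite divr_gt0.
have t1 : 1 <= t by rewrite ler_pdivlMr// mul1r; lra.
exists (4 * t); first by rewrite mulr_gt0.
move=> mu Emu Vmu.
have [mu1 mu2] := moments12_of_mean_variance Emu Vmu.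
have [[L0 [L0_gt0 suppL0]]|noL] :=
    pselect (exists L, 0 < L /\ supp mu `<=` `[- L, L]); last first.
  by exists 0%N => L L_gt0 suppL; case: noL; exists L.
(* Since [n0] must not depend on [L], it is taken from one admissible [L0];
   below, [M = min L L0] is admissible and is bounded by both. *)
pose b := t * (12 * L0) ^+ 4.
have b0 : 0 < b by rewrite mulr_gt0// exprn_gt0// mulr_gt0.
exists (Num.bound b) => L L_gt0 suppL A X _ _ Xmu free.
exists (fun n => [set v : borel_rV R n | sphere v /\ coefficient_size v <= t]).
split=> [n|n theta].
  split; [exact: measurable_small_coefficients|by move=> v []|].
  move=> sigma unif.
  rewrite (_ : rho = 18 / t); first exact: size_markov.
  by rewrite /t; field; rewrite gt_eqF.
move=> bn [sth th_le] mu_theta Smu r.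
have nb : b <= n%:R.
  apply: le_trans (ltW (archi_boundP (ltW b0))) _.
  by rewrite ler_nat.
have n_gt0 : (0 < n)%N by rewrite -(ltr0n R) (lt_le_trans b0).
pose M := Num.min L L0.
have M0 : 0 < M by rewrite lt_min L_gt0.
have ML : M <= L by rewrite ge_min lexx.
have ML0 : M <= L0 by rewrite ge_min lexx orbT.
have suppM : supp mu `<=` `[- M, M].
  move=> y suppy; have := suppL y suppy; have := suppL0 y suppy.
  by rewrite /= !in_itv/= -!ler_norml /M le_min => -> ->.
have M4 : M ^+ 4 <= L ^+ 4 by rewrite lerXn2r// nnegrE ltW.
have Mb : t * (12 * M) ^+ 4 <= n%:R.
  apply: le_trans nb; rewrite ler_pM2l// lerXn2r// ?ler_pM2l//.
    by rewrite nnegrE mulr_ge0// ltW.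
  by rewrite nnegrE mulr_ge0// ltW.
have [Q_le K_le th_small] := small_coefficients t1 M0 Mb n_gt0 th_le.
have := free_weighted_sum_supp M0 suppM mu1 mu2 Xmu free sth th_small Smu.
move=> /= sub y /sub; rewrite /= !in_itv/= => /andP[y1 y2].
have n0 : 0 < n%:R^-1 :> R by rewrite invr_gt0 ltr0n.
have m3_le : `|moment mu 3| * `|\sum_i theta ord0 i ^+ 3| <=
    `|moment mu 3| * (t / n%:R) by rewrite ler_wpM2l.
have tail_le : 2 * (6 * M) ^+ 4 * (\sum_i theta ord0 i ^+ 4) <=
    2592 * L ^+ 4 * (t / n%:R).
  apply: ler_pM => //.
  - by rewrite mulr_ge0// exprn_ge0// mulr_ge0// ltW.
  - by apply: sumr_ge0 => i _; rewrite (exprM _ 2 2) sqr_ge0.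
  - by rewrite exprMn; lra.
have L4 : 0 < L ^+ 4 * (t / n%:R) by rewrite mulr_gt0 ?exprn_gt0// mulr_gt0.
have m3_ge0 : 0 <= `|moment mu 3| * (t / n%:R).
  by rewrite mulr_ge0// ltW// mulr_gt0.
(* The factor [4] suffices because [2 * 6 ^+ 4 = 2592 < 3072 = 4 * 768]; the
   strict inequality keeps the end points out. *)
have rE : r = 3072 * (L ^+ 4 * (t / n%:R)) +
    24 * (`|moment mu 3| * (t / n%:R)) by rewrite /r; ring.
by apply/andP; rewrite rE; split; lra.
Qed.
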